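(* A homogeneous binary quintic $F$ over $\mathbb{C}$ can be factored as $L^3M^2$ for some linear forms $L,M$ if and only if the covariants $$25\,H^2-6\,i\,F^2,\qquad 5\,i\,H+6\,F\,(i,F)^2,\qquad 2\,i^2+15\,(i,H)^2\qquad\text{and}\qquad A$$ all vanish on $F$, where $H=(F,F)^2$, $i=(F,F)^4$, $A=(i,i)^2$.
   Context: All forms are in the variables $x,y$ over $\mathbb{C}$. For binary forms $\Phi_1,\Phi_2$ of degrees $q_1,q_2$ and $1\le r\le\min(q_1,q_2)$, $(\Phi_1,\Phi_2)^r$ denotes the $r$-th transvectant, a binary form of degree $q_1+q_2-2r$, normalized by the symbolic method: it is bilinear in $(\Phi_1,\Phi_2)$ and for powers of linear forms $$\big((\alpha_1x+\alpha_2y)^{q_1},(\beta_1x+\beta_2y)^{q_2}\big)^r=(\alpha_1\beta_2-\alpha_2\beta_1)^r(\alpha_1x+\alpha_2y)^{q_1-r}(\beta_1x+\beta_2y)^{q_2-r}.$$ (In other words: if $\Phi_i=\sum_k\varphi_{ik}x^ky^{q_i-k}$, expand the right-hand side and substitute $\varphi_{1k}$ for $\binom{q_1}{k}\alpha_1^k\alpha_2^{q_1-k}$ and $\varphi_{2k}$ for $\binom{q_2}{k}\beta_1^k\beta_2^{q_2-k}$.) The superscript in $(\cdot,\cdot)^r$ is the transvectant order, whereas $H^2,F^2,i^2$ are ordinary squares. Here $H$ has degree $6$ and $i$ has degree $2$ in $x,y$. A covariant ''vanishes on $F$'' if it is identically zero as a polynomial in $x,y$ when evaluated at $F$. *)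

(* Defs.v *)
From HB Require Import structures.
From mathcomp Require Import all_boot all_order all_algebra.
From mathcomp Require Import reals.
From mathcomp Require Import complex mpoly.
From mathcomp Require Import zify ring.

Set Implicit Arguments.
Unset Strict Implicit.
Unset Printing Implicit Defensive.

Import Order.TTheory GRing.Theory Num.Theory.
Local Open Scope ring_scope.

(* A binary form of degree d is an element of {mpoly K[2]} that is d.-homog,
   with x = 'X_0 and y = 'X_1; the zero polynomial is a form of every degree. *)

Definition xy (a b : nat) : 'X_{1..2} := (U_(0%R) *+ a + U_(1%R) *+ b)%MM.

Section Transvectant.
Variable K : fieldType.

Definition linform (a1 a2 : K) : {mpoly K[2]} := a1 *: 'X_0 + a2 *: 'X_1.

(* The r-th transvectant (F, G)^r of forms of degrees q1 and q2.  Expanding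
     (a1 b2 - a2 b1)^r (a1 x + a2 y)^(q1 - r) (b1 x + b2 y)^(q2 - r)
   gives, for j <= r, s <= q1 - r and t <= q2 - r, the terms
     (-1)^j C(r,j) C(q1-r,s) C(q2-r,t) a1^k a2^(q1-k) b1^l b2^(q2-l)
       x^(s+t) y^(q1+q2-2r-(s+t))     with k = r - j + s and l = j + t,
   in which a1^k a2^(q1-k) is replaced by the coefficient of x^k y^(q1-k) in F
   divided by C(q1,k), and b1^l b2^(q2-l) likewise with G.
   The degrees are arguments because the zero form does not determine its
   degree. *)
Definition transvectant (q1 q2 r : nat) (F G : {mpoly K[2]}) : {mpoly K[2]} :=
  \sum_(j < r.+1) \sum_(s < (q1 - r).+1) \sum_(t < (q2 - r).+1)
    ((-1) ^+ j * ('C(r, j) * 'C(q1 - r, s) * 'C(q2 - r, t))%:R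
     * (F@_(xy (r - j + s) (q1 - (r - j + s))) / 'C(q1, r - j + s)%:R)
     * (G@_(xy (j + t) (q2 - (j + t))) / 'C(q2, j + t)%:R))
    *: 'X_[xy (s + t) (q1 - r + (q2 - r) - (s + t))].

Lemma transvectant_linearl q1 q2 r c F1 F2 G :
  transvectant q1 q2 r (c *: F1 + F2) G =
  c *: transvectant q1 q2 r F1 G + transvectant q1 q2 r F2 G.
Proof.
rewrite /transvectant; do 3!(rewrite scaler_sumr -big_split; apply: eq_bigr => ? _ /=).
rewrite scalerA -scalerDl mcoeffD mcoeffZ; congr (_ *: _).
by rewrite mulrDl mulrDr mulrDl -!mulrA; congr (_ + _); rewrite !(mulrCA _ c).
Qed.

Lemma transvectant_linearr q1 q2 r c F G1 G2 :
  transvectant q1 q2 r F (c *: G1 + G2) =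
  c *: transvectant q1 q2 r F G1 + transvectant q1 q2 r F G2.
Proof.
rewrite /transvectant; do 3!(rewrite scaler_sumr -big_split; apply: eq_bigr => ? _ /=).
rewrite scalerA -scalerDl mcoeffD mcoeffZ; congr (_ *: _).
by rewrite mulrDl mulrDr -!mulrA; congr (_ + _); rewrite !(mulrCA _ c).
Qed.

Lemma mpolyXxy a b : 'X_[xy a b] = 'X_0 ^+ a * 'X_1 ^+ b :> {mpoly K[2]}.
Proof. by rewrite /xy mpolyXD !mpolyXn. Qed.

Lemma xy_inj a b a' b' : (xy a b == xy a' b') = (a == a') && (b == b').
Proof.
apply/eqP/andP => [/mnmP e|[/eqP-> /eqP->] //].
move: (e 0%R) (e 1%R); rewrite /xy !mnmDE !mulmnE !mnm1E !eqxx /=.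
by rewrite !mul1n !mul0n !addn0 !add0n => -> ->.
Qed.

Lemma linform_exp a1 a2 q :
  linform a1 a2 ^+ q =
  \sum_(k < q.+1) (a1 ^+ k * a2 ^+ (q - k) * 'C(q, k)%:R) *: 'X_[xy k (q - k)].
Proof.
rewrite /linform addrC exprDn; apply: eq_bigr => k _.
rewrite mpolyXxy !exprZn -scalerAl -scalerAr scalerA -scaler_nat scalerA.
by rewrite ['X_1 ^+ _ * _]mulrC; congr (_ *: _); ring.
Qed.

End Transvectant.

Section Normalization.
Variable K : numFieldType.

Lemma mcoeff_linform_exp (a1 a2 : K) q k : (k <= q)%N ->
  (linform a1 a2 ^+ q)@_(xy k (q - k)) / 'C(q, k)%:R = a1 ^+ k * a2 ^+ (q - k).
Proof.
move=> kq; rewrite linform_exp raddf_sum /=.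
rewrite (bigD1 (Ordinal (kq : (k < q.+1)%N))) //= big1 ?addr0.
  by rewrite mcoeffZ mcoeffX eqxx mulr1 mulfK // pnatr_eq0 -lt0n bin_gt0.
move=> i ik; rewrite mcoeffZ mcoeffX xy_inj.
have -> : (i == k :> nat) = false by apply: contraNF ik => /eqP e; apply/eqP/val_inj.
by rewrite mulr0.
Qed.

Theorem transvectant_powers (a1 a2 b1 b2 : K) q1 q2 r :
  (r <= q1)%N -> (r <= q2)%N ->
  transvectant q1 q2 r (linform a1 a2 ^+ q1) (linform b1 b2 ^+ q2) =
  (a1 * b2 - a2 * b1) ^+ r
    *: (linform a1 a2 ^+ (q1 - r) * linform b1 b2 ^+ (q2 - r)).
Proof.
move=> r1 r2; rewrite exprBn scaler_suml; apply: eq_bigr => -[j /= jr] _.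
rewrite ltnS in jr.
rewrite [X in _ = _ *: (X * _)]linform_exp [X in _ = _ *: (_ * X)]linform_exp.
rewrite mulr_suml scaler_sumr; apply: eq_bigr => -[s /= sr] _.
rewrite ltnS in sr.
rewrite mulr_sumr scaler_sumr; apply: eq_bigr => -[t /= tr] _.
rewrite ltnS in tr.
have ks : (r - j + s <= q1)%N by rewrite -(subnKC r1) leq_add // leq_subr.
have lt : (j + t <= q2)%N by rewrite -(subnKC r2) leq_add.
rewrite !mcoeff_linform_exp // -scalerAl -scalerAr !scalerA -mpolyXD.
have -> : (xy s (q1 - r - s) + xy t (q2 - r - t))%MM
        = xy (s + t) (q1 - r + (q2 - r) - (s + t)).
  have -> : (q1 - r + (q2 - r) - (s + t) = (q1 - r - s) + (q2 - r - t))%N by lia.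
  by apply/mnmP => i; rewrite /xy !(mnmDE, mulmnE); lia.
congr (_ *: _); rewrite !natrM !exprMn.
have -> : (q1 - (r - j + s) = j + (q1 - r - s))%N by lia.
have -> : (q2 - (j + t) = (r - j) + (q2 - r - t))%N by lia.
rewrite !exprD -mulr_natr; ring.
Qed.

End Normalization.

(* Main.v *)
Require Import Defs.
From HB Require Import structures.
From mathcomp Require Import all_boot all_order all_algebra.
From mathcomp Require Import reals.
From mathcomp Require Import complex mpoly.
From mathcomp Require Import ring.

Import Order.TTheory GRing.Theory Num.Theory.
Local Open Scope ring_scope.

(** The covariants of F = l^3 m^2 are products of powers of l and m: with [l m]
the bracket of the two linear forms, i is proportional to [l m]^4 l^2, H to
[l m]^2 l^4 m^2, (i,F)^2 to [l m]^6 l^3 and (i,H)^2 to [l m]^8 l^4, while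
A = 0 because l^2 has no transvectant of order 2 with itself
([transvectant4_cube_square] and its neighbours). The numerical coefficients of
the four covariants are those for which these products cancel.

Conversely, A is proportional to the discriminant of the quadratic form i, so
A = 0 makes i a square l^2 over an algebraically closed field. If l = 0, the
first covariant gives H = 0; the ten coefficients of H and i together span the
2 x 2 minors of the Hankel matrix of the normalized coefficients of F, so this
matrix has rank at most 1 and F is a fifth power ([hankel_fifth_power]).

If l and F are nonzero, put T = (i,F)^2. The first two covariants give
5 i H = - 6 F T and 25 H^2 = 6 i F^2, from which H can be eliminated:
6 T^2 = i^3 = l^6, so T is a scalar multiple of l^3. In coordinates where
l = x, T is the second derivative of F in y up to a constant, so that this says
that F = x^3 Q(x,y) with Q a quadratic form (the terms of F of degree at most 1
in y are divisible by x^4); without change of coordinates, it is a linear recurrence on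
the coefficients of F, which is solved in [cube_square_of_polar]. Once F = l^3 Q
is known, one extreme coefficient of the second covariant is the discriminant
of Q times a nonzero power of a coefficient of l; so Q is a square m^2. *)

(** Evaluates the closed natural numbers left by the expansion of a sum over
ordinals, so that equal monomials become syntactically equal. *)
Ltac eval_nat :=
  repeat match goal with
  | |- context [bump ?m ?n] =>
      let v := eval vm_compute in (bump m n) in change (bump m n) with v
  | |- context [subn ?m ?n] =>
      let v := eval vm_compute in (subn m n) in change (subn m n) with v
  | |- context [addn ?m ?n] =>
      let v := eval vm_compute in (addn m n) in change (addn m n) with v
  | |- context [muln ?m ?n] =>
      let v := eval vm_compute in (muln m n) in change (muln m n) with v
  | |- context [binomial ?m ?n] =>
      let v := eval vm_compute in (binomial m n) in change (binomial m n) with v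
  end.

(** * Binary forms with binomially normalized coefficients *)

Section Forms.
Set Implicit Arguments.
Unset Strict Implicit.
Unset Printing Implicit Defensive.
Variable K : numFieldType.
Implicit Types (a b c : nat -> K) (F G : {mpoly K[2]}).

(** The form whose coefficient of x^k y^(n-k) is C(n,k) c_k: with this
normalization the n-th power of p x + q y has c_k = p^k q^(n-k), and
transvectants have integer structure constants. *)
Definition binform (n : nat) (c : nat -> K) : {mpoly K[2]} :=
  \sum_(k < n.+1) (c k * 'C(n, k)%:R) *: 'X_[xy k (n - k)].

Lemma mcoeff_binform n c k : (k <= n)%N ->
  (binform n c)@_(xy k (n - k)) / 'C(n, k)%:R = c k.
Proof.
move=> kn; rewrite raddf_sum /= (bigD1 (Ordinal (kn : (k < n.+1)%N))) //=.
rewrite big1 ?addr0 => [|j jk].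
  by rewrite mcoeffZ mcoeffX eqxx mulr1 mulfK // pnatr_eq0 -lt0n bin_gt0.
rewrite mcoeffZ mcoeffX xy_inj; case: eqP => [e|_]; last by rewrite mulr0.
by case/eqP: jk; apply: val_inj.
Qed.

Lemma binform_inj n c c' : binform n c = binform n c' ->
  forall k, (k <= n)%N -> c k = c' k.
Proof. by move=> e k kn; rewrite -[LHS](mcoeff_binform _ kn) e mcoeff_binform. Qed.

Lemma eq_binform n c c' : (forall k, (k <= n)%N -> c k = c' k) ->
  binform n c = binform n c'.
Proof. by move=> e; apply: eq_bigr => k _; rewrite e // -ltnS. Qed.

Lemma binform_eq0 n c : binform n c = 0 -> forall k, (k <= n)%N -> c k = 0.
Proof.
move=> e; apply: (@binform_inj n c (fun=> 0)); rewrite e /binform big1 // => k _.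
by rewrite mul0r scale0r.
Qed.

Lemma homog_binform n F : F \is n.-homog ->
  F = binform n (fun k => F@_(xy k (n - k)) / 'C(n, k)%:R).
Proof.
move=> hF; apply/mpolyP => m; rewrite raddf_sum /=.
have em : m = xy (m 0%R) (m 1%R).
  apply/mnmP => j; rewrite /xy mnmDE !mulmnE !mnm1E.
  by case: j => [[|[|//]] ?]; rewrite /= ?mul1n ?mul0n ?addn0; congr (m _);
  apply: val_inj.
have dm : mdeg m = (m 0%R + m 1%R)%N.
  by rewrite mdegE big_ord_recl big_ord1; congr (_ + m _)%N; apply: val_inj.
have [mn|mn] := eqVneq (mdeg m) n.
  have kn : (m 0%R < n.+1)%N by rewrite -mn dm ltnS leq_addr.
  rewrite (bigD1 (Ordinal kn)) //= big1 ?addr0 => [|j jk].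
    rewrite mcoeffZ mcoeffX mulfVK ?pnatr_eq0 -?lt0n ?bin_gt0 //.
    have -> : xy (m 0%R) (n - m 0%R) = m by rewrite -mn dm addKn -em.
    by rewrite eqxx mulr1.
  rewrite mcoeffZ mcoeffX em xy_inj; case: eqP => [e|_]; last by rewrite mulr0.
  by case/eqP: jk; apply: val_inj.
rewrite (dhomog_nemf_coeff hF mn) big1 // => j _.
rewrite mcoeffZ mcoeffX em xy_inj; case: eqP => [e|_]; last by rewrite mulr0.
case: eqP => [e'|_]; last by rewrite mulr0.
by case/eqP: mn; rewrite dm -e -e' subnKC // -ltnS.
Qed.

Lemma binform_homog n c : binform n c \is n.-homog.
Proof.
rewrite rpred_sum // => k _; rewrite rpredZ //.
rewrite dhomogX /xy /= mdegD !mdegMn !mdeg1 !mul1n.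
by rewrite subnKC // -ltnS.
Qed.

(** The binomials of the normalization cancel the divisions in the
transvectant. *)
Lemma transvectant_binform q1 q2 r a b : (r <= q1)%N -> (r <= q2)%N ->
  transvectant q1 q2 r (binform q1 a) (binform q2 b) =
  \sum_(j < r.+1) \sum_(s < (q1 - r).+1) \sum_(t < (q2 - r).+1)
    ((-1) ^+ j * ('C(r, j) * 'C(q1 - r, s) * 'C(q2 - r, t))%:R
     * a (r - j + s)%N * b (j + t)%N)
    *: 'X_[xy (s + t) (q1 - r + (q2 - r) - (s + t))].
Proof.
move=> r1 r2; apply: eq_bigr => -[j /= jr] _; apply: eq_bigr => -[s /= sr] _.
apply: eq_bigr => -[t /= tr] _; rewrite !mcoeff_binform //.
  by rewrite -(subnKC r2) leq_add.
by rewrite -(subnKC r1) leq_add // leq_subr.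
Qed.

(** With a quadratic form on the left, the second transvectant is the action of
a second-order differential operator; on normalized coefficients it becomes a
three-term recurrence. *)
Lemma transvectant_quadratic n a b :
  transvectant 2 n.+2 2 (binform 2 a) (binform n.+2 b) =
  binform n (fun t => a 2%N * b t - 2%:R * a 1%N * b t.+1 + a 0%N * b t.+2).
Proof.
rewrite transvectant_binform // subnn subn2; under eq_bigr do rewrite big_ord1.
rewrite [LHS]big_ord_recl [X in _ + X]big_ord_recl [X in _ + (_ + X)]big_ord1 /=.
rewrite -!big_split; apply: eq_bigr => t _ /=.
rewrite -!scalerDl /bump /=.
rewrite !addn0 !add0n !add1n !mul1n; congr (_ *: _).
rewrite bin1 bin0 subn0 subnn add2n !muln1 !natrM; ring.
Qed.

(** The same forms given by their plain coefficients, to be used when the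
division by the binomials would get in the way. *)
Definition plainform n (w : seq K) := binform n (fun k => w`_k / 'C(n, k)%:R).

Lemma plainformE n w :
  plainform n w = \sum_(k < n.+1) (w`_k)%:MP * ('X_0 ^+ k * 'X_1 ^+ (n - k)).
Proof.
apply: eq_bigr => -[k kn] _ /=.
by rewrite mulfVK ?pnatr_eq0 -?lt0n ?bin_gt0 // mpolyXxy mul_mpolyC.
Qed.

Lemma plainform_eq0 n w : plainform n w = 0 -> forall k, (k <= n)%N -> w`_k = 0.
Proof.
move=> e k kn; have /eqP := binform_eq0 e kn.
by rewrite mulf_eq0 invr_eq0 pnatr_eq0 -leqn0 leqNgt bin_gt0 kn orbF => /eqP.
Qed.

Lemma linform_binform p q n :
  linform p q ^+ n = binform n (fun k => p ^+ k * q ^+ (n - k)).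
Proof. exact: linform_exp. Qed.

Lemma meval_binform_01 n c : (binform n c).@[fun j => (j == 1)%:R] = c 0%N.
Proof.
rewrite raddf_sum big_ord_recl big1 => [|j _] /=.
  rewrite mevalZ mpolyXxy mevalM !rmorphXn /= !mevalXU.
  by rewrite expr0 subn0 expr1n bin0 !mulr1 addr0.
by rewrite mevalZ mpolyXxy mevalM !rmorphXn /= !mevalXU /= exprS !(mul0r, mulr0).
Qed.

Lemma meval_binform_10 n c : (binform n c).@[fun j => (j == 0)%:R] = c n.
Proof.
rewrite raddf_sum big_ord_recr big1 => [|j _] /=.
  rewrite mevalZ mpolyXxy mevalM !rmorphXn /= !mevalXU.
  by rewrite subnn expr0 expr1n binn !mulr1 add0r.
rewrite mevalZ mpolyXxy mevalM !rmorphXn /= !mevalXU /=.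
by rewrite -(subnSK (ltn_ord j)) exprS !(mul0r, mulr0).
Qed.

Lemma homog_linform F : F \is 1.-homog -> exists p q, F = linform p q.
Proof.
move/homog_binform=> ->; set c := (fun k : nat => _).
exists (c 1%N), (c 0%N); rewrite -[RHS]expr1 linform_binform; apply: eq_binform.
by move=> [|[|//]] _ /=; rewrite ?mul1r ?mulr1.
Qed.

Lemma linform_homog (p q : K) : linform p q \is 1.-homog.
Proof. by rewrite -[linform p q]expr1 linform_binform binform_homog. Qed.

(** * Coefficients of i, H and of products of linear forms *)

Lemma transvectant4_quintic a :
  transvectant 5 5 4 (binform 5 a) (binform 5 a) =
  plainform 2 [:: 2%:R * (a 0%N * a 4%N - 4%:R * a 1%N * a 3%N + 3%:R * a 2%N ^+ 2);
            2%:R * (a 0%N * a 5%N - 3%:R * a 1%N * a 4%N + 2%:R * a 2%N * a 3%N);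
            2%:R * (a 1%N * a 5%N - 4%:R * a 2%N * a 4%N + 3%:R * a 3%N ^+ 2)].
Proof.
rewrite transvectant_binform // plainformE !big_ord_recl !big_ord0 /=.
rewrite -!mul_mpolyC !mpolyXxy; eval_nat; ring.
Qed.

Lemma transvectant2_quintic a :
  transvectant 5 5 2 (binform 5 a) (binform 5 a) =
  plainform 6 [:: 2%:R * (a 0%N * a 2%N - a 1%N ^+ 2);
            6%:R * (a 0%N * a 3%N - a 1%N * a 2%N);
            6%:R * (a 0%N * a 4%N + a 1%N * a 3%N - 2%:R * a 2%N ^+ 2);
            2%:R * (a 0%N * a 5%N + 7%:R * a 1%N * a 4%N - 8%:R * a 2%N * a 3%N);
            6%:R * (a 1%N * a 5%N + a 2%N * a 4%N - 2%:R * a 3%N ^+ 2);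
            6%:R * (a 2%N * a 5%N - a 3%N * a 4%N);
            2%:R * (a 3%N * a 5%N - a 4%N ^+ 2)].
Proof.
rewrite transvectant_binform // plainformE !big_ord_recl !big_ord0 /=.
rewrite -!mul_mpolyC !mpolyXxy; eval_nat; ring.
Qed.

Lemma linform_cube_square p q u v :
  linform p q ^+ 3 * linform u v ^+ 2 =
  plainform 5 [:: q ^+ 3 * v ^+ 2;
    3%:R * p * q ^+ 2 * v ^+ 2 + 2%:R * q ^+ 3 * u * v;
    3%:R * p ^+ 2 * q * v ^+ 2 + 6%:R * p * q ^+ 2 * u * v + q ^+ 3 * u ^+ 2;
    p ^+ 3 * v ^+ 2 + 6%:R * p ^+ 2 * q * u * v + 3%:R * p * q ^+ 2 * u ^+ 2;
    2%:R * p ^+ 3 * u * v + 3%:R * p ^+ 2 * q * u ^+ 2;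
    p ^+ 3 * u ^+ 2].
Proof.
rewrite plainformE !big_ord_recl big_ord0 /linform -!mul_mpolyC /=; eval_nat; ring.
Qed.

Lemma linform_fourth_square p q u v :
  linform p q ^+ 4 * linform u v ^+ 2 =
  plainform 6 [:: q ^+ 4 * v ^+ 2;
    4%:R * p * q ^+ 3 * v ^+ 2 + 2%:R * q ^+ 4 * u * v;
    6%:R * p ^+ 2 * q ^+ 2 * v ^+ 2 + 8%:R * p * q ^+ 3 * u * v + q ^+ 4 * u ^+ 2;
    4%:R * p ^+ 3 * q * v ^+ 2 + 12%:R * p ^+ 2 * q ^+ 2 * u * v
      + 4%:R * p * q ^+ 3 * u ^+ 2;
    p ^+ 4 * v ^+ 2 + 8%:R * p ^+ 3 * q * u * v + 6%:R * p ^+ 2 * q ^+ 2 * u ^+ 2;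
    2%:R * p ^+ 4 * u * v + 4%:R * p ^+ 3 * q * u ^+ 2;
    p ^+ 4 * u ^+ 2].
Proof.
rewrite plainformE !big_ord_recl big_ord0 /linform -!mul_mpolyC /=; eval_nat; ring.
Qed.

Lemma linform_cube_binform p q c :
  linform p q ^+ 3 * binform 2 c =
  plainform 5 [:: q ^+ 3 * c 0%N;
    3%:R * p * q ^+ 2 * c 0%N + 2%:R * q ^+ 3 * c 1%N;
    3%:R * p ^+ 2 * q * c 0%N + 6%:R * p * q ^+ 2 * c 1%N + q ^+ 3 * c 2%N;
    p ^+ 3 * c 0%N + 6%:R * p ^+ 2 * q * c 1%N + 3%:R * p * q ^+ 2 * c 2%N;
    2%:R * p ^+ 3 * c 1%N + 3%:R * p ^+ 2 * q * c 2%N;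
    p ^+ 3 * c 2%N].
Proof.
rewrite plainformE /binform !big_ord_recl !big_ord0 /linform -!mul_mpolyC !mpolyXxy /=.
eval_nat; ring.
Qed.

(** * The covariants of l^3 m^2 *)

(** The square of the bracket of the two linear forms; dividing it by 50 clears
denominators in the values of the covariants. *)
Definition bracket2 (p q u v : K) : K := (p * v - q * u) ^+ 2 / 50%:R.

(** The shape of the right-hand side is forced by covariance: for independent l
and m, sending them to x and y reduces it to the value at x^3 y^2, which fixes
the constant, and the determinant of this change of variables contributes the
bracket powers. The next three lemmas are of the same kind. *)
Lemma transvectant4_cube_square p q u v :
  let l := linform p q in let m := linform u v in
  transvectant 5 5 4 (l ^+ 3 * m ^+ 2) (l ^+ 3 * m ^+ 2) =
  (150%:R * bracket2 p q u v ^+ 2) *: l ^+ 2.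
Proof.
move=> l m; rewrite /l /m linform_cube_square transvectant4_quintic linform_binform.
rewrite /binform scaler_sumr; apply: eq_bigr => -[k kn] _ /=.
rewrite scalerA; congr (_ *: _).
move: k kn => [|[|[|//]]] _ /=.
all: by rewrite /bracket2; eval_nat; field.
Qed.

Lemma transvectant2_cube_square p q u v :
  let l := linform p q in let m := linform u v in
  transvectant 5 5 2 (l ^+ 3 * m ^+ 2) (l ^+ 3 * m ^+ 2) =
  (- 6%:R * bracket2 p q u v) *: (l ^+ 4 * m ^+ 2).
Proof.
move=> l m; rewrite /l /m linform_cube_square transvectant2_quintic.
rewrite linform_fourth_square.
rewrite /binform scaler_sumr; apply: eq_bigr => -[k kn] _ /=.
rewrite scalerA; congr (_ *: _).
move: k kn => [|[|[|[|[|[|[|//]]]]]]] _ /=.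
all: by rewrite /bracket2; eval_nat; field.
Qed.

Lemma transvectant_square_cube_square p q u v :
  let l := linform p q in let m := linform u v in
  transvectant 2 5 2 (l ^+ 2) (l ^+ 3 * m ^+ 2) =
  (5%:R * bracket2 p q u v) *: l ^+ 3.
Proof.
move=> l m; rewrite /l /m linform_cube_square !linform_binform transvectant_quadratic.
rewrite /binform scaler_sumr; apply: eq_bigr => -[k kn] _ /=.
rewrite scalerA; congr (_ *: _).
move: k kn => [|[|[|[|//]]]] _ /=.
all: by rewrite /bracket2; eval_nat; field.
Qed.

Lemma transvectant_square_fourth_square p q u v :
  let l := linform p q in let m := linform u v in
  transvectant 2 6 2 (l ^+ 2) (l ^+ 4 * m ^+ 2) =
  (10%:R / 3%:R * bracket2 p q u v) *: l ^+ 4.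
Proof.
move=> l m; rewrite /l /m linform_fourth_square !linform_binform transvectant_quadratic.
rewrite /binform scaler_sumr; apply: eq_bigr => -[k kn] _ /=.
rewrite scalerA; congr (_ *: _).
move: k kn => [|[|[|[|[|//]]]]] _ /=.
all: by rewrite /bracket2; eval_nat; field.
Qed.

Lemma transvectantZl q1 q2 r (c : K) F G :
  transvectant q1 q2 r (c *: F) G = c *: transvectant q1 q2 r F G.
Proof.
have T0 : transvectant q1 q2 r 0 G = 0.
  have := transvectant_linearl q1 q2 r (-1) 0 0 G.
  by rewrite scaler0 addr0 scaleN1r addNr.
by have := transvectant_linearl q1 q2 r c F 0 G; rewrite T0 !addr0.
Qed.

Lemma transvectantZr q1 q2 r (c : K) F G :
  transvectant q1 q2 r F (c *: G) = c *: transvectant q1 q2 r F G.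
Proof.
have T0 : transvectant q1 q2 r F 0 = 0.
  have := transvectant_linearr q1 q2 r (-1) F 0 0.
  by rewrite scaler0 addr0 scaleN1r addNr.
by have := transvectant_linearr q1 q2 r c F G 0; rewrite T0 !addr0.
Qed.

Lemma covariants_cube_square (p q u v : K) (F := linform p q ^+ 3 * linform u v ^+ 2) :
  let H := transvectant 5 5 2 F F in
  let i := transvectant 5 5 4 F F in
  let A := transvectant 2 2 2 i i in
  [/\ 25%:R * H ^+ 2 - 6%:R * i * F ^+ 2 = 0,
      5%:R * i * H + 6%:R * F * transvectant 2 5 2 i F = 0,
      2%:R * i ^+ 2 + 15%:R * transvectant 2 6 2 i H = 0
    & A = 0].
Proof.
move=> H i A.
have eH : H = _ := transvectant2_cube_square p q u v.
have ei : i = _ := transvectant4_cube_square p q u v.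
have -> : A = 0.
  rewrite /A ei transvectantZl transvectantZr transvectant_powers //.
  by rewrite [p * q]mulrC subrr expr0n /= scale0r !scaler0.
rewrite eH ei !transvectantZl transvectantZr transvectant_square_fourth_square.
rewrite transvectant_square_cube_square.
rewrite /F !scalerA -!mul_mpolyC; move: (bracket2 p q u v) => w.
split=> //; [ring|ring|].
(* Collecting the constants leaves an identity with integer coefficients. *)
have -> : 150%:R * w ^+ 2 * (- 6%:R * w) * (10%:R / 3%:R * w) = - 3000%:R * w ^+ 4.
  by field.
ring.
Qed.

End Forms.

(** * Vanishing covariants force the factorization *)

Section Closed.
Set Implicit Arguments.
Unset Strict Implicit.
Unset Printing Implicit Defensive.
Variable K : numClosedFieldType.
Implicit Types (a b c : nat -> K).

(** These two lemmas let an equation be proved by exhibiting it as a linear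
combination of known ones, the remaining identity being left to [field]. *)
Lemma eq_multiple (s t u v c : K) : u = v -> s - t = c * (u - v) -> s = t.
Proof. by move=> ->; rewrite subrr mulr0 => /subr0_eq. Qed.
Arguments eq_multiple {s t u v} c _ _.

Lemma eq_lincomb (s t u v w x c d : K) :
  u = v -> w = x -> s - t = c * (u - v) + d * (w - x) -> s = t.
Proof. by move=> -> ->; rewrite !subrr !mulr0 addr0 => /subr0_eq. Qed.
Arguments eq_lincomb {s t u v w x} c d _ _ _.

Lemma quadratic_square c : c 0%N * c 2%N = c 1%N ^+ 2 ->
  exists p q, binform 2 c = linform p q ^+ 2.
Proof.
move=> e; suff [p [q [e0 e1 e2]]] :
    exists p q, [/\ c 0%N = q ^+ 2, c 1%N = p * q & c 2%N = p ^+ 2].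
  exists p, q; rewrite linform_binform; apply: eq_binform.
  by move=> [|[|[|//]]] _ /=; rewrite ?(e0, e1, e2) ?mul1r ?mulr1.
have [c0|c0] := eqVneq (c 0%N) 0.
  move/eqP: e; rewrite c0 mul0r eq_sym sqrf_eq0 => /eqP c1.
  by exists (sqrtC (c 2%N)), 0; rewrite sqrtCK mulr0 expr0n c1 ?c0.
exists (c 1%N / sqrtC (c 0%N)), (sqrtC (c 0%N)).
rewrite sqrtCK mulfVK ?sqrtC_eq0 // expr_div_n sqrtCK -e.
by split=> //; rewrite mulrAC mulfV ?mul1r.
Qed.

(** The coefficients of H and i span the ten 2 x 2 minors of the matrix with
rows a_0 .. a_4 and a_1 .. a_5. When they vanish, the rows are proportional,
hence the a_k form a geometric progression, or only a_5 is nonzero. *)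
Lemma hankel_fifth_power a :
  transvectant 5 5 2 (binform 5 a) (binform 5 a) = 0 ->
  transvectant 5 5 4 (binform 5 a) (binform 5 a) = 0 ->
  exists p q u v, binform 5 a = linform p q ^+ 3 * linform u v ^+ 2.
Proof.
rewrite transvectant2_quintic transvectant4_quintic => /plainform_eq0 hH /plainform_eq0 hi.
have cancel (n : nat) (x y : K) : n.+1%:R * (x - y) = 0 -> x = y.
  by move/eqP; rewrite mulf_eq0 pnatr_eq0 subr_eq0 => /eqP.
have /= h0 := hH 0%N isT; have /= h1 := hH 1%N isT; have /= h2 := hH 2%N isT.
have /= h3 := hH 3%N isT; have /= h4 := hH 4%N isT; have /= h6 := hH 6%N isT.
have /= i0 := hi 0%N isT; have /= i1 := hi 1%N isT; have /= i2 := hi 2%N isT.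
have m02 : a 0%N * a 2%N = a 1%N ^+ 2 by exact: cancel h0.
have m03 : a 0%N * a 3%N = a 1%N * a 2%N by exact: cancel h1.
have m13 : a 1%N * a 3%N = a 2%N ^+ 2.
  by apply: (eq_lincomb (30%:R^-1) (- 10%:R^-1) h2 i0); field.
have m04 : a 0%N * a 4%N = a 1%N * a 3%N.
  by apply: (eq_lincomb (10%:R^-1) (5%:R^-1) h2 i0); field.
have m14 : a 1%N * a 4%N = a 2%N * a 3%N.
  by apply: (eq_lincomb (20%:R^-1) (- 20%:R^-1) h3 i1); field.
have m05 : a 0%N * a 5%N = a 1%N * a 4%N.
  by apply: (eq_lincomb (10%:R^-1) (2%:R / 5%:R) h3 i1); field.
have m24 : a 2%N * a 4%N = a 3%N ^+ 2.
  by apply: (eq_lincomb (30%:R^-1) (- 10%:R^-1) h4 i2); field.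
have m35 : a 3%N * a 5%N = a 4%N ^+ 2 by exact: cancel h6.
suff [p [q [z e]]] : exists p q z, binform 5 a = z *: linform p q ^+ 5.
  exists p, q, (sqrtC z * p), (sqrtC z * q); rewrite e.
  have -> : linform (sqrtC z * p) (sqrtC z * q) = sqrtC z *: linform p q.
    by rewrite /linform scalerDr !scalerA.
  by rewrite exprZn sqrtCK -scalerAr -exprD.
have [a0|a0] := eqVneq (a 0%N) 0.
  have sq0 (x : K) : 0 = x ^+ 2 -> x = 0.
    by move/esym/eqP; rewrite sqrf_eq0 => /eqP.
  have a1 : a 1%N = 0 by apply: sq0; rewrite -m02 a0 mul0r.
  have a2 : a 2%N = 0 by apply: sq0; rewrite -m13 a1 mul0r.
  have a3 : a 3%N = 0 by apply: sq0; rewrite -m24 a2 mul0r.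
  have a4 : a 4%N = 0 by apply: sq0; rewrite -m35 a3 mul0r.
  exists 1, 0, (a 5%N); rewrite linform_binform /binform scaler_sumr.
  apply: eq_bigr => -[k kn] _ /=; rewrite scalerA; congr (_ *: _).
  move: k kn => [|[|[|[|[|[|//]]]]]] _ /=; rewrite ?(a0, a1, a2, a3, a4);
  by rewrite expr1n ?expr0n !(mul0r, mulr0, mulr1, mul1r).
exists (a 1%N / a 0%N), 1, (a 0%N).
rewrite linform_binform /binform scaler_sumr.
apply: eq_bigr => -[k kn] _ /=; rewrite scalerA expr1n mulr1; congr (_ *: _).
have nth_a j : a 0%N * a j.+1 = a 1%N * a j -> a j = a 0%N * (a 1%N / a 0%N) ^+ j ->
    a j.+1 = a 0%N * (a 1%N / a 0%N) ^+ j.+1.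
  move=> e ej; apply: (mulfI a0); rewrite e ej exprS; field; exact: a0.
have e0 : a 0%N = a 0%N * (a 1%N / a 0%N) ^+ 0 by rewrite expr0 mulr1.
have e1 := nth_a 0%N (mulrC _ _) e0.
have e2 := nth_a 1%N m02 e1; have e3 := nth_a 2%N m03 e2.
have e4 := nth_a 3%N m04 e3; have e5 := nth_a 4%N m05 e4.
rewrite mulrA; congr (_ * _); by move: k kn => [|[|[|[|[|[|//]]]]]] _.
Qed.

(** The recurrence says that (l^2, F)^2 = z l^3 for l = p x + q y. If q is
nonzero, it determines a_2 .. a_5 from a_0 and a_1, and its solutions are the
coefficients of l^3 Q; if q = 0, it kills a_0, a_1 and a_2. The last two
hypotheses are the extreme coefficients of the second covariant; the one at the
end where l does not vanish is the discriminant of Q up to a nonzero factor. *)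
Lemma cube_square_of_polar a (p q z : K) : (p != 0) || (q != 0) ->
    (forall t, (t <= 3)%N ->
       p ^+ 2 * a t - 2%:R * (p * q) * a t.+1 + q ^+ 2 * a t.+2
       = z * (p ^+ t * q ^+ (3 - t))) ->
    5%:R * q ^+ 2 * (2%:R * (a 0%N * a 2%N - a 1%N ^+ 2))
      + 6%:R * a 0%N * (z * q ^+ 3) = 0 ->
    5%:R * p ^+ 2 * (2%:R * (a 3%N * a 5%N - a 4%N ^+ 2))
      + 6%:R * a 5%N * (z * p ^+ 3) = 0 ->
  exists u v, binform 5 a = linform p q ^+ 3 * linform u v ^+ 2.
Proof.
move=> nz rec h0 h5.
suff [c [/quadratic_square [u [v e]] ->]] :
    exists c, c 0%N * c 2%N = c 1%N ^+ 2 /\ binform 5 a = linform p q ^+ 3 * binform 2 c.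
  by exists u, v; rewrite e.
have /= r0 := rec 0%N isT; have /= r1 := rec 1%N isT.
have /= r2 := rec 2%N isT; have /= r3 := rec 3%N isT.
have [q0|q0] := eqVneq q 0.
  have p0 : p != 0 by move: nz; rewrite q0 eqxx orbF.
  subst q.
  have a0 : a 0%N = 0 by apply: (eq_multiple (p ^- 2) r0); field.
  have a1 : a 1%N = 0 by apply: (eq_multiple (p ^- 2) r1); field.
  have a2 : a 2%N = 0 by apply: (eq_multiple (p ^- 2) r2); field.
  have a3 : a 3%N = z * p by apply: (eq_multiple (p ^- 2) r3); field.
  (* Here l = p x, and Q is F / (p x)^3. *)
  pose c k := nth 0 [:: 10%:R * z / p ^+ 2; 5%:R * a 4%N / (2%:R * p ^+ 3);
                     a 5%N / p ^+ 3] k.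
  exists c; split.
    apply/eqP; rewrite -subr_eq0 /c /=; apply/eqP.
    have -> : 10%:R * z / p ^+ 2 * (a 5%N / p ^+ 3) -
       (5%:R * a 4%N / (2%:R * p ^+ 3)) ^+ 2 =
       5%:R / 8%:R / p ^+ 8 * (5%:R * p ^+ 2 * (2%:R * (a 3%N * a 5%N - a 4%N ^+ 2))
      + 6%:R * a 5%N * (z * p ^+ 3)).
      by rewrite a3; field.
    by rewrite h5 mulr0.
  rewrite linform_cube_binform; apply: eq_binform.
  move=> [|[|[|[|[|[|//]]]]]] _; rewrite /c /= ?(a0, a1, a2, a3); eval_nat;
  by field.
pose a2 := (z * q ^+ 3 - p ^+ 2 * a 0%N + 2%:R * p * q * a 1%N) / q ^+ 2.
pose a3 := (z * (p * q ^+ 2) - p ^+ 2 * a 1%N + 2%:R * p * q * a2) / q ^+ 2.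
pose a4 := (z * (p ^+ 2 * q) - p ^+ 2 * a2 + 2%:R * p * q * a3) / q ^+ 2.
pose a5 := (z * p ^+ 3 - p ^+ 2 * a3 + 2%:R * p * q * a4) / q ^+ 2.
have e2 : a 2%N = a2 by apply: (eq_multiple (q ^- 2) r0); rewrite /a2; field.
have e3 : a 3%N = a3.
  by apply: (eq_multiple (q ^- 2) r1); rewrite /a3 -e2; field.
have e4 : a 4%N = a4.
  by apply: (eq_multiple (q ^- 2) r2); rewrite /a4 -e3 -e2; field.
have e5 : a 5%N = a5.
  by apply: (eq_multiple (q ^- 2) r3); rewrite /a5 -e4 -e3; field.
(* Q is obtained by dividing F by l^3, starting from the power of y. *)
pose c0 := a 0%N / q ^+ 3.
pose c1 := (5%:R * a 1%N - 3%:R * p * q ^+ 2 * c0) / (2%:R * q ^+ 3).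
pose c2 := (10%:R * a2 - 3%:R * p ^+ 2 * q * c0 - 6%:R * p * q ^+ 2 * c1) / q ^+ 3.
exists (fun k => nth 0 [:: c0; c1; c2] k); split.
  apply/eqP; rewrite -subr_eq0 /=; apply/eqP.
  have -> : c0 * c2 - c1 ^+ 2 =
       5%:R / 8%:R / q ^+ 8 * (5%:R * q ^+ 2 * (2%:R * (a 0%N * a 2%N - a 1%N ^+ 2))
      + 6%:R * a 0%N * (z * q ^+ 3)).
    by rewrite e2 /c2 /c1 /c0 /a2; field.
  by rewrite h0 mulr0.
rewrite linform_cube_binform; apply: eq_binform.
move=> [|[|[|[|[|[|//]]]]]] _ /=; rewrite ?(e2, e3, e4, e5); eval_nat;
by rewrite /c2 /c1 /c0 /a5 /a4 /a3 /a2; field.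
Qed.

Lemma cube_square_of_covariants a (F := binform 5 a) :
  let H := transvectant 5 5 2 F F in
  let i := transvectant 5 5 4 F F in
  let A := transvectant 2 2 2 i i in
  25%:R * H ^+ 2 - 6%:R * i * F ^+ 2 = 0 ->
  5%:R * i * H + 6%:R * F * transvectant 2 5 2 i F = 0 ->
  A = 0 ->
  exists p q u v, F = linform p q ^+ 3 * linform u v ^+ 2.
Proof.
move=> H i A eH eT eA.
have [F0|F0] := eqVneq F 0.
  by exists 0, 0, 0, 0; rewrite F0 /linform !scale0r addr0 expr0n mul0r.
have [p [q ei]] : exists p q, i = linform p q ^+ 2.
  move: eA; rewrite /A /i transvectant4_quintic /plainform.
  set c := (fun k : nat => _); rewrite transvectant_quadratic => /binform_eq0/(_ 0%N isT) e0.
  apply: quadratic_square.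
  by apply: (eq_multiple (2%:R^-1) e0); field.
have [/norP[]|nz] := boolP (~~ ((p != 0) || (q != 0))).
  rewrite !negbK => /eqP p0 /eqP q0.
  have i0 : i = 0 by rewrite ei p0 q0 /linform !scale0r addr0 expr0n.
  apply: (@hankel_fifth_power a _ i0); apply/eqP; rewrite -/F -/H -sqrf_eq0.
  move/eqP: eH; rewrite i0 mulr0 mul0r subr0 mulf_eq0.
  by rewrite -mpolyC_nat mpolyC_eq0 pnatr_eq0.
rewrite negbK in nz.
set T := transvectant 2 5 2 i F in eT.
have [z eTz] : exists z, T = z *: linform p q ^+ 3.
  have eT2 : (sqrtC 6%:R *: T) ^+ 2 = (linform p q ^+ 3) ^+ 2.
    rewrite exprZn sqrtCK -exprM mulnC exprM -ei -mul_mpolyC mpolyC_nat.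
    have F2 : 6%:R * F ^+ 2 != 0.
      by rewrite mulf_neq0 ?expf_neq0 // -mpolyC_nat mpolyC_eq0 pnatr_eq0.
    (* Multiplied by 6 F^2, the equation contains F T only, which can be
    exchanged for i H by the second covariant; the first one then removes H. *)
    apply: (mulfI F2).
    have eT' : 6%:R * F * T = - (5%:R * i * H) by apply/eqP; rewrite -addr_eq0 addrC eT.
    have eH' : 25%:R * H ^+ 2 = 6%:R * i * F ^+ 2 by apply/eqP; rewrite -subr_eq0 eH.
    transitivity ((6%:R * F * T) ^+ 2); first by ring.
    rewrite eT'; transitivity (i ^+ 2 * (25%:R * H ^+ 2)); first by ring.
    by rewrite eH'; ring.
  have s0 : sqrtC 6%:R != 0 :> K by rewrite sqrtC_eq0 pnatr_eq0.
  move/eqP: eT2; rewrite eqf_sqr => /orP[] /eqP e.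
    exists (sqrtC 6%:R)^-1.
    by rewrite -e scalerA mulVf // scale1r.
  exists (- (sqrtC 6%:R)^-1).
  by rewrite scaleNr -scalerN -e scalerA mulVf // scale1r.
have eTc : T = binform 3 (fun t => z * (p ^+ t * q ^+ (3 - t))).
  rewrite eTz linform_binform /binform scaler_sumr.
  by apply: eq_bigr => k _; rewrite scalerA mulrA.
have [u [v e]] : exists u v, F = linform p q ^+ 3 * linform u v ^+ 2.
  apply: (@cube_square_of_polar a p q z nz).
  - move=> t t3; have := eTc.
    rewrite /T ei linform_binform transvectant_quadratic => /binform_inj/(_ t t3) <-.
    by rewrite !(expr0, expr1, mul1r, mulr1).
  (* Evaluation at (0,1) and (1,0) reads off the extreme coefficients. *)
  - have := congr1 (meval (fun j => (j == 1)%:R)) eT.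
    rewrite eTc ei /H transvectant2_quintic linform_binform raddfD /= !mevalM.
    rewrite -!mpolyC_nat !mevalC !meval_binform_01.
    by rewrite bin0 divr1 !subn0 expr0 !mul1r.
  have := congr1 (meval (fun j => (j == 0)%:R)) eT.
  rewrite eTc ei /H transvectant2_quintic linform_binform raddfD /= !mevalM.
  rewrite -!mpolyC_nat !mevalC !meval_binform_10.
  by rewrite binn divr1 !subnn expr0 !mulr1.
by exists p, q, u, v.
Qed.

End Closed.

Theorem theorem4p3 (R : realType) (F : {mpoly R[i][2]}) (hF : F \is 5.-homog) :
  let H := transvectant 5 5 2 F F in
  let i := transvectant 5 5 4 F F in
  let A := transvectant 2 2 2 i i in
  (exists L M : {mpoly R[i][2]},
     [/\ L \is 1.-homog, M \is 1.-homog & F = L ^+ 3 * M ^+ 2])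
  <->
  [/\ 25%:R * H ^+ 2 - 6%:R * i * F ^+ 2 = 0,
      5%:R * i * H + 6%:R * F * transvectant 2 5 2 i F = 0,
      2%:R * i ^+ 2 + 15%:R * transvectant 2 6 2 i H = 0
    & A = 0].
Proof.
have [a ->] : exists a, F = binform 5 a by eexists; exact: homog_binform hF.
move=> H i A; split=> [[L [M [/homog_linform[p [q ->]] /homog_linform[u [v ->]] eF]]]|].
  by have := covariants_cube_square p q u v; rewrite -eF.
case=> eH eT _ eA; have [p [q [u [v ->]]]] := cube_square_of_covariants eH eT eA.
by exists (linform p q), (linform u v); split=> //; exact: linform_homog.
Qed.
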